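(* Let $X$ be a topological space. The Kolmogorov quotient $X/{\equiv}$ of $X$ is a Kolmogorov space.
   Context: Let $X$ be a topological space. Points $x,y\in X$ are topologically indistinguishable, written $x\equiv y$, if every open set containing $x$ contains $y$ and vice versa; this is an equivalence relation on $X$. A topological space is a Kolmogorov space (or $T_0$-space) if $x\equiv y$ implies $x=y$, i.e. all pairs of distinct points are topologically distinguishable. The Kolmogorov quotient $X/{\equiv}$ is the set of equivalence classes $\eta(x)=\{y\in X\mid y\equiv x\}$, with the quotient topology: a set is open in $X/{\equiv}$ if and only if its preimage under $\eta\colon X\to X/{\equiv}$ is open in $X$. *)

(* Defs.v *)
From HB Require Import structures.
From mathcomp Require Import all_boot.
From mathcomp Require Import all_classical.
From mathcomp Require Import topology.

Set Implicit Arguments.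
Unset Strict Implicit.
Unset Printing Implicit Defensive.

Local Open Scope classical_set_scope.
Local Open Scope quotient_scope.

Section KolmogorovQuotient.
Context {X : topologicalType}.

Definition top_indist (x y : X) : Prop :=
  (forall U : set X, open U -> U x -> U y) /\
  (forall U : set X, open U -> U y -> U x).

(* [equiv_rel] is built on boolean relations, hence the coercion of
   [top_indist] to [bool] by classical logic. *)
Definition top_indistb : rel X := fun x y => `[< top_indist x y >].

Lemma top_indistb_refl : reflexive top_indistb.
Proof. by move=> x; apply/asboolP. Qed.

Lemma top_indistb_sym : symmetric top_indistb.
Proof. by move=> x y; apply/asboolP/asboolP => -[xy yx]; split. Qed.

Lemma top_indistb_trans : transitive top_indistb.
Proof.
move=> y x z /asboolP[xy yx] /asboolP[yz zy].
by apply/asboolP; split=> U oU Uw; [exact: yz (xy _ oU Uw) | exact: yx (zy _ oU Uw)].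
Qed.

Canonical top_indist_equiv : equiv_rel X :=
  EquivRel top_indistb top_indistb_refl top_indistb_sym top_indistb_trans.

End KolmogorovQuotient.

Definition kolmogorov_quotient (X : topologicalType) : topologicalType :=
  quotient_topology {eq_quot (@top_indist_equiv X)}.

Definition kolmogorov_pi (X : topologicalType) (x : X) :
    kolmogorov_quotient X :=
  \pi_{eq_quot (@top_indist_equiv X)} x.

Lemma kolmogorov_pi_eq (X : topologicalType) (x y : X) :
  kolmogorov_pi x = kolmogorov_pi y <-> top_indist x y.
Proof.
split; first by move=> /eqmodP/asboolP.
by move=> xy; apply/eqmodP/asboolP.
Qed.

Lemma kolmogorov_pi_surj (X : topologicalType) (q : kolmogorov_quotient X) :
  exists x : X, kolmogorov_pi x = q.
Proof.
by exists (repr (q : {eq_quot (@top_indist_equiv X)})); exact: reprK.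
Qed.

Lemma open_kolmogorov_quotient (X : topologicalType)
    (V : set (kolmogorov_quotient X)) :
  open V <-> open (@kolmogorov_pi X @^-1` V).
Proof. by []. Qed.

(* The library phrases T0 with neighbourhoods rather than with topological
   indistinguishability. *)
Lemma kolmogorov_spaceP (T : topologicalType) :
  kolmogorov_space T <-> forall x y : T, top_indist x y -> x = y.
Proof.
split=> [T0 x y [xy yx]|T0 x y /eqP nxy].
  apply/eqP; apply: contrapT => /negP/T0[A].
  rewrite !inE !nbhsE => -[[[U [oU Ux] UA] nA]|[[U [oU Uy] UA] nA]]; apply: nA.
    exact/UA/(xy _ oU Ux).
  exact/UA/(yx _ oU Uy).
have /not_andP[] : ~ top_indist x y by move/T0.
- move=> /existsNP[U /not_implyP[oU /not_implyP[Ux nUy]]].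
  by exists U; left; rewrite !inE; split=> //; exact: open_nbhs_nbhs.
- move=> /existsNP[U /not_implyP[oU /not_implyP[Uy nUx]]].
  by exists U; right; rewrite !inE; split=> //; exact: open_nbhs_nbhs.
Qed.

(* Main.v *)
Require Import Defs.
From mathcomp Require Import all_boot all_classical topology.

(** An open set is a union of indistinguishability classes, so it is the full
    preimage of its image in the quotient ([kolmogorov_pi_saturated]), and that
    image is therefore open ([open_kolmogorov_pi_image]). The open sets of [X]
    and of its quotient thus correspond under the projection; a pair of classes
    that no open set of the quotient separates has representatives that no open
    set of [X] separates ([top_indist_kolmogorov_pi]), and these representatives
    have the same class. *)

Local Open Scope classical_set_scope.

(** A point of the preimage has the same class as a point of [U], and [U], being
    open, cannot contain one of two indistinguishable points without the
    other. *)
Lemma kolmogorov_pi_saturated (X : topologicalType) (U : set X) :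
  open U -> @kolmogorov_pi X @^-1` (@kolmogorov_pi X @` U) = U.
Proof.
move=> oU; apply/seteqP; split=> [x [y Uy /kolmogorov_pi_eq[yx _]]|x Ux].
  exact: yx oU Uy.
by exists x.
Qed.

Lemma open_kolmogorov_pi_image (X : topologicalType) (U : set X) :
  open U -> open (@kolmogorov_pi X @` U).
Proof.
by move=> oU; apply/open_kolmogorov_quotient; rewrite kolmogorov_pi_saturated.
Qed.

Lemma top_indist_kolmogorov_pi (X : topologicalType) (x y : X) :
  top_indist (kolmogorov_pi x) (kolmogorov_pi y) -> top_indist x y.
Proof.
move=> [xy yx]; split=> U oU Uz; rewrite -(kolmogorov_pi_saturated _ _ oU).
  by apply: xy; [exact: open_kolmogorov_pi_image | exists x].
by apply: yx; [exact: open_kolmogorov_pi_image | exists y].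
Qed.

Theorem theorem3p19 (X : topologicalType) :
  kolmogorov_space (kolmogorov_quotient X).
Proof.
apply/kolmogorov_spaceP => p q.
have [x <-] := kolmogorov_pi_surj p; have [y <-] := kolmogorov_pi_surj q.
by move=> /top_indist_kolmogorov_pi /kolmogorov_pi_eq.
Qed.
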